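(* For every $\alpha\in(0,1)$ there exists a constant $C$ depending on $\alpha$ only such that the following holds. Let $n\ge1$, $\sigma>0$, $\beta\in(0,1-\alpha)$, let $\{S_m,m\in\mathcal M_n\}$ be a finite family of linear subspaces of $\mathbb R^n$ and $(\beta_m)_{m\in\mathcal M_n}$ numbers in $(0,1)$ such that the index $n$ belongs to $\mathcal M_n$, $S_n=\mathbb R^n$, and $\sum_{m\in\mathcal M_n}\beta_m\le\beta$. Put $\mathcal D_m=\dim S_m$ and assume $\mathcal D_m\le n/2$ for all $m\in\mathcal M_n\setminus\{n\}$. Let $\rho_m$ be defined as in the context. Then for all $m\in\mathcal M_n$, $$\rho_m^2\le C\max\{\mathcal D_m,\ \sqrt{n\log(1/\beta_m)},\ \log(1/\beta_m)\}\,\sigma^2 .$$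
   Context: For $z\ge0$ and integer $d\ge1$, $\chi^2_{z,d}(\cdot)$ is the distribution function of the noncentral $\chi^2$ distribution with $d$ degrees of freedom and noncentrality parameter $z$ (the law of $\|\mu+\xi\|^2$ with $\xi$ standard Gaussian in $\mathbb R^d$ and $\|\mu\|^2=z$, of mean $z+d$), and $q_{z,d}(u)$ is its $(1-u)$-quantile: if $X$ has this law then $\mathbb P(X\ge q_{z,d}(u))=u$ for $u\in(0,1)$. Convention: $q_{0,d}(1)=-\infty$. $a\wedge b=\min(a,b)$. Put $N_m=n-\mathcal D_m$. The radii $\rho_m\ge0$ are defined by: for $m=n$, $\rho_n^2=q_{0,n}(\beta_n)\sigma^2$; for $m\ne n$ with $\mathcal D_m\neq0$, $$\rho_m^2=\sup_{z\ge0}\left[z+q_{0,\mathcal D_m}\left(\frac{\beta_m}{\chi^2_{z,N_m}(q_{0,N_m}(\alpha))}\wedge1\right)\right]\sigma^2 ;$$ for $m\neq n$ with $\mathcal D_m=0$, $\rho_m^2=\inf\{z\ge0:\ \chi^2_{z,n}(q_{0,n}(\alpha))\le\beta_m\}\,\sigma^2$. *)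

(* Defs.v *)
From HB Require Import structures.
From mathcomp Require Import all_boot all_order all_algebra.
From mathcomp Require Import all_classical all_reals all_analysis.
From mathcomp Require Import measurable_realfun.

Set Implicit Arguments.
Unset Strict Implicit.
Unset Printing Implicit Defensive.

Import Order.TTheory GRing.Theory Num.Theory.
Import numFieldNormedType.Exports.

Local Open Scope classical_set_scope.
Local Open Scope ring_scope.

Section gaussian.
Context {R : realType}.

Definition cons_pair d (p : measurableTypeR R * d.-tuple R) : d.+1.-tuple R :=
  [tuple of p.1 :: p.2].

Lemma measurable_cons_pair d : measurable_fun setT (@cons_pair d).
Proof.
apply: (@measurable_cons _ _ _ R fst d snd).
- exact: measurable_fst.
- exact: measurable_snd.
Qed.

HB.instance Definition _ d :=
  isMeasurableFun.Build _ _ _ _ (@cons_pair d) (@measurable_cons_pair d).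

(* The law N(0, I_d) on R^d, as the d-fold product of N(0, 1): the library has
   binary product measures only. *)
Fixpoint std_gaussian d : probability (d.-tuple R) R :=
  match d with
  | 0 => \d_([tuple] : 0.-tuple R)
  | d'.+1 => distribution (normal_prob (0 : R) 1 \x std_gaussian d')%E
               (@cons_pair d' : {mfun _ >-> _})
  end.

Lemma measurable_box d (A : 'I_d -> set R) :
  (forall i, measurable (A i)) ->
  measurable [set x : d.-tuple R | forall i, A i (tnth x i)].
Proof.
move=> mA.
rewrite (_ : [set x | _] = \bigcap_(i in [set: 'I_d])
  [set x : d.-tuple R | A i (tnth x i)]); last first.
  by apply/seteqP; split => x /= Ax i => [_|]; exact: Ax.
refine (fin_bigcap_measurable finite_finset _) => i _.
by have := @measurable_tnth _ R d i measurableT (A i) (mA i); rewrite setTI.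
Qed.

Lemma std_gaussian_box d (A : 'I_d -> set R) :
  (forall i, measurable (A i)) ->
  (std_gaussian d [set x | forall i, A i (tnth x i)] =
   \prod_(i < d) normal_prob (0 : R) 1 (A i))%E.
Proof.
elim: d A => [|d IHd] A mA.
  rewrite big_ord0 /= diracE mem_set//= => -[]//.
rewrite big_ord_recl -(IHd (fun i => A (lift ord0 i)))//= -product_measure1E;
  [|exact: mA|exact: (measurable_box (fun i => mA (lift ord0 i)))].
congr (_ _); apply/seteqP; split => -[y x] /=.
- move=> Ayx; split => [|i]; first exact: (Ayx ord0).
  by have := Ayx (lift ord0 i); rewrite tnthS.
- move=> [Ay Ax] i; have [j ->|->] := unliftP ord0 i; last by [].
  by rewrite tnthS; exact: Ax.
Qed.

Definition sq_dist d (mu : 'rV[R]_d) (x : d.-tuple R) : R :=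
  \sum_(i < d) (mu 0 i + tnth x i) ^+ 2.

Lemma measurable_sq_dist d (mu : 'rV[R]_d) : measurable_fun setT (sq_dist mu).
Proof.
apply: measurable_sum => i; apply: measurable_funX; apply: measurable_funD => //.
exact: measurable_tnth.
Qed.

HB.instance Definition _ d (mu : 'rV[R]_d) :=
  isMeasurableFun.Build _ _ _ _ (sq_dist mu) (measurable_sq_dist mu).

(* For d > 0 and z >= 0 a vector of squared norm z. The law of ||mu + xi||^2
   depends on mu only through ||mu||^2, by rotation invariance. *)
Definition ncp_mean (z : R) d : 'rV[R]_d :=
  \row_(i < d) (if (i : nat) == 0%N then Num.sqrt z else 0).

Lemma sqnorm_ncp_mean z d : 0 <= z -> (0 < d)%N ->
  \sum_(i < d) ncp_mean z d 0 i ^+ 2 = z.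
Proof.
case: d => // d z0 _; rewrite big_ord_recl mxE /= sqr_sqrtr// big1 ?addr0// => i _.
by rewrite mxE expr0n.
Qed.

Definition ncchi2_cdf (z : R) d (x : R) : R :=
  fine (cdf (sq_dist (ncp_mean z d) : {RV std_gaussian d >-> R}) x).

(* The (1 - u)-quantile. The infimum is taken in \bar R, so that u = 1 gives
   -oo and u = 0 gives +oo, since a chi2 law has unbounded support. *)
Definition ncchi2_quantile (z : R) d (u : R) : \bar R :=
  ereal_inf [set x%:E | x in [set x : R | 1 - u <= ncchi2_cdf z d x]].

(* The squared radius rho_m ^ 2; [top] is the index of the whole space. It is
   \bar R-valued, so that a supremum or an infimum that failed to be finite would
   be +oo and not some real default. [fine] only acts on quantiles at
   alpha in ]0, 1[, which are real numbers. *)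
Definition sq_radius n (sigma alpha : R) (M : finType) (top : M)
    (S : M -> {vspace 'rV[R]_n}) (beta : M -> R) (m : M) : \bar R :=
  let D := \dim (S m) in
  let N := (n - D)%N in
  let accept k z := ncchi2_cdf z k (fine (ncchi2_quantile 0 k alpha)) in
  ((if m == top then ncchi2_quantile 0 n (beta m)
    else if D == 0%N then
      ereal_inf [set z%:E | z in [set z : R | 0 <= z /\ accept n z <= beta m]%R]
    else
      ereal_sup
        [set z%:E + ncchi2_quantile 0 D (Num.min (beta m / accept N z)%R 1%R)
        | z in [set z : R | 0 <= z]%R])
   * (sigma ^+ 2)%:E)%E.

End gaussian.

(* Main.v *)
(* A Gaussian integral gives the Laplace transform
     E exp(k ||mu + xi||^2) = (1 - 2k)^(-d/2) exp(k ||mu||^2 / (1 - 2k)), k < 1/2.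
   Chernoff's bound with k > 0 and mu = 0 yields q_{0,d}(u) <= 4 (d + log(1/u))
   and q_{0,N}(alpha) <= N + A sqrt N, A depending on alpha only. With
   k = - min(1/2, sqrt(L/N)) and L = log(1/beta_m) it yields
   chi2_{z,N}(q_{0,N}(alpha)) <= exp(-L) = beta_m as soon as
   z >= z* := K (sqrt(n L) + L); here the term A sqrt N is absorbed by sqrt(n L),
   because beta_m < 1 - alpha bounds L from below. So in the supremum defining
   rho_m^2 the values z > z* contribute -oo, and the others at most
   z* + 4 (D_m + L). *)
Require Import Defs.
From mathcomp Require Import all_boot all_order all_algebra.
From mathcomp Require Import all_classical all_reals all_analysis.
From mathcomp Require Import measurable_realfun ring lra.

Set Implicit Arguments.
Unset Strict Implicit.
Unset Printing Implicit Defensive.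

Import Order.TTheory GRing.Theory Num.Theory.
Import numFieldNormedType.Exports.

Local Open Scope ring_scope.

(** * Laplace transform of the squared norm of a Gaussian vector *)

(** The Radon-Nikodym derivative of the normal law and [normal_pdf] have the same integral over
    every measurable set, so they agree almost everywhere. *)
Lemma ge0_integral_normal_prob (R : realType) (m s : R) (f : R -> R) :
  measurable_fun setT f -> (forall x, 0 <= f x) ->
  (\int[normal_prob m s]_x (f x)%:E =
   \int[lebesgue_measure]_x (f x * normal_pdf m s x)%:E)%E.
Proof.
move=> mf f0.
pose nu : {finite_measure set (measurableTypeR R) -> \bar R} := normal_prob m s.
have dom : normal_prob m s `<< (@lebesgue_measure R).
  exact: normal_prob_dominates.
have mEf : measurable_fun setT (EFin \o f) by exact/measurable_EFinP.
rewrite -[LHS](@Radon_Nikodym_SigmaFinite.change_of_variables _ _ _ nu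
  (@lebesgue_measure R) dom (EFin \o f) setT)//=.
have mpdf : measurable_fun setT (EFin \o normal_pdf m s).
  by apply/measurable_EFinP; exact: measurable_normal_pdf.
apply: ae_eq_integral => //=.
- apply: emeasurable_funM => //.
  by apply: measurable_int; exact: Radon_Nikodym_SigmaFinite.f_integrable.
- by apply/measurable_EFinP; apply: measurable_funM => //; exact: measurable_normal_pdf.
- apply: (@ae_eqe_mul2l _ _ _ _ _ (Radon_Nikodym_SigmaFinite.f nu lebesgue_measure)
    (EFin \o normal_pdf m s) (EFin \o f)) => //=.
  apply: integral_ae_eq => //=.
  + exact: Radon_Nikodym_SigmaFinite.f_integrable.
  + by move=> E _ mE; rewrite -Radon_Nikodym_SigmaFinite.f_integral.
Qed.

(** Completing the square: with [s = 1 - 2 * k], the integrand times the N(0, 1) density is a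
    constant times the density of N(2km/s, 1/s), whose integral is 1. *)
Lemma normal_prob_laplace (R : realType) (m k : R) : k < 1 / 2 ->
  (\int[normal_prob (0 : R) 1]_x (expR (k * (m + x) ^+ 2))%:E =
   ((Num.sqrt (1 - 2 * k))^-1 * expR (k * m ^+ 2 / (1 - 2 * k)))%:E)%E.
Proof.
move=> k12; set s := 1 - 2 * k.
have s0 : 0 < s by rewrite /s; lra.
have sq0 : 0 < Num.sqrt s by rewrite sqrtr_gt0.
have msq : measurable_fun setT (fun x : R => expR (k * (m + x) ^+ 2)).
  apply: measurableT_comp => //; apply: measurable_funM => //.
  by apply: measurable_funX; exact: measurable_funD.
rewrite ge0_integral_normal_prob//.
have E x : expR (k * (m + x) ^+ 2) * normal_pdf 0 1 x =
    (Num.sqrt s)^-1 * expR (k * m ^+ 2 / s)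
      * normal_pdf (2 * k * m / s) (Num.sqrt s)^-1 x.
  rewrite !normal_pdfE ?oner_eq0 ?invr_eq0 ?gt_eqF//.
  rewrite /normal_peak /normal_fun exprVn sqr_sqrtr ?ltW// subr0 expr1n mul1r.
  have -> : Num.sqrt (s^-1 * pi *+ 2) = (Num.sqrt s)^-1 * Num.sqrt (pi *+ 2).
    by rewrite -mulrnAr sqrtrM ?invr_ge0 ?ltW// sqrtrV// ltW.
  rewrite invfM invrK mulrCA -expRD.
  transitivity ((Num.sqrt (pi *+ 2))^-1 * ((Num.sqrt s)^-1 * Num.sqrt s)
     * expR (k * m ^+ 2 / s + - (x - 2 * k * m / s) ^+ 2 / (s^-1 *+ 2))); last first.
    rewrite expRD; ring.
  rewrite mulVf ?gt_eqF// mulr1; congr (_ * expR _).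
  have : s != 0 by rewrite gt_eqF.
  (* Eliminating [k] leaves [s] as the only denominator to be checked nonzero. *)
  have -> : k = (1 - s) / 2 by rewrite /s; field.
  by move=> ?; field.
under eq_integral do rewrite E EFinM.
rewrite ge0_integralZl//=.
- by rewrite integral_normal_pdf mule1.
- by apply/measurable_EFinP; exact: measurable_normal_pdf.
- by move=> x _; rewrite lee_fin normal_pdf_ge0.
Qed.

Lemma measurable_expR_sq_dist (R : realType) (d : nat) (mu : 'rV[R]_d) (k : R) :
  measurable_fun setT (fun t => (expR (k * sq_dist mu t))%:E).
Proof.
apply/measurable_EFinP; apply: measurableT_comp => //.
by apply: measurable_funM => //; exact: measurable_sq_dist.
Qed.

Lemma sq_dist_cons (R : realType) (d : nat) (mu : 'rV[R]_d.+1)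
    (p : measurableTypeR R * d.-tuple R) :
  sq_dist mu (cons_pair p) =
  (mu 0 0 + p.1) ^+ 2 + sq_dist (\row_i mu 0 (lift ord0 i)) p.2.
Proof.
rewrite /sq_dist big_ord_recl /= tnth0; congr (_ + _).
by apply: eq_bigr => i _; rewrite mxE tnthS.
Qed.

(** Induction on [d]: Tonelli splits off the first coordinate, and the exponential of the sum
    factors. *)
Lemma std_gaussian_laplace (R : realType) (d : nat) (mu : 'rV[R]_d) (k : R) :
  k < 1 / 2 ->
  (\int[std_gaussian d]_t (expR (k * sq_dist mu t))%:E =
   ((Num.sqrt (1 - 2 * k))^-1 ^+ d
     * expR (k * (\sum_(i < d) mu 0 i ^+ 2) / (1 - 2 * k)))%:E)%E.
Proof.
move=> k12; elim: d mu => [|d IHd] mu.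
  rewrite /std_gaussian integral_dirac//; last exact: measurable_expR_sq_dist.
  by rewrite diracT mul1e /sq_dist !big_ord0 mulr0 mul0r expR0 expr0 mulr1.
rewrite /= ge0_integral_distribution; last 2 first.
- exact: measurable_expR_sq_dist.
- by move=> y; rewrite lee_fin expR_ge0.
rewrite fubini_tonelli1; last 2 first.
- by apply: measurableT_comp; [exact: measurable_expR_sq_dist|exact: measurable_cons_pair].
- by move=> y; rewrite lee_fin expR_ge0.
pose c := (Num.sqrt (1 - 2 * k))^-1 ^+ d
  * expR (k * (\sum_(i < d) mu 0 (lift ord0 i) ^+ 2) / (1 - 2 * k)).
transitivity (\int[normal_prob (0 : R) 1]_x
    ((expR (k * (mu 0 0 + x) ^+ 2))%:E * c%:E))%E.
  apply: eq_integral => x _; rewrite /fubini_F.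
  under eq_integral => y _ do rewrite /= sq_dist_cons/= mulrDr expRD EFinM.
  rewrite ge0_integralZl//=; last exact: measurable_expR_sq_dist.
  by rewrite IHd /c; under eq_bigr do rewrite mxE.
rewrite ge0_integralZr//=; last 2 first.
- apply/measurable_EFinP; apply: measurableT_comp => //; apply: measurable_funM => //.
  by apply: measurable_funX; exact: measurable_funD.
- by rewrite lee_fin mulr_ge0 ?expR_ge0// exprn_ge0// invr_ge0 sqrtr_ge0.
rewrite normal_prob_laplace// -EFinM; congr EFin.
rewrite big_ord_recl mulrACA -exprS -expRD; congr (_ * expR _).
by rewrite mulrDr mulrDl.
Qed.

(** * Chernoff bounds for the distribution functions *)

(** Markov's inequality for [expR (k * sq_dist mu t)]. Keeping [k] on both sides of the condition on
    [A] serves both tails: upper for [k > 0], lower for [k < 0]. *)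
Lemma std_gaussian_chernoff (R : realType) (d : nat) (mu : 'rV[R]_d) (k x : R)
    (A : set (d.-tuple R)) :
  k < 1 / 2 -> measurable A -> (forall t, A t -> k * x <= k * sq_dist mu t) ->
  (std_gaussian d A <=
   (expR (- (k * x)) * ((Num.sqrt (1 - 2 * k))^-1 ^+ d
     * expR (k * (\sum_(i < d) mu 0 i ^+ 2) / (1 - 2 * k))))%:E)%E.
Proof.
move=> k12 mA Ax.
rewrite EFinM -std_gaussian_laplace// expRN lee_pdivlMl ?expR_gt0//.
rewrite -integral_cst//.
apply: (@le_trans _ _ (\int[std_gaussian d]_(t in A) (expR (k * sq_dist mu t))%:E)%E).
  apply: ge0_le_integral => //=.
  - by apply: measurable_funTS; exact: measurable_expR_sq_dist.
  - by move=> t At; rewrite lee_fin ler_expR Ax.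
by apply: ge0_subset_integral => //=; exact: measurable_expR_sq_dist.
Qed.

Lemma le_ncchi2_cdf (R : realType) (z : R) (d : nat) (x : R) (l : R) :
  0 <= z -> (0 < d)%N -> 0 <= l ->
  ncchi2_cdf z d x <=
  expR (l * x) * ((Num.sqrt (1 + 2 * l))^-1 ^+ d * expR (- (l * z / (1 + 2 * l)))).
Proof.
move=> z0 d0 l0; rewrite /ncchi2_cdf -lee_fin fineK ?fin_num_measure//.
have H : - l < 1 / 2 by lra.
have := @std_gaussian_chernoff R d (ncp_mean z d) (- l) x
  (sq_dist (ncp_mean z d) @^-1` `]-oo, x]) H.
rewrite sqnorm_ncp_mean// !mulrN !mulNr !opprK; apply.
  by rewrite -[X in measurable X]setTI; exact: measurable_sq_dist.
by move=> t /=; rewrite in_itv/= mulNr lerN2 => ?; exact: ler_wpM2l.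
Qed.

Lemma ge_chi2_cdf (R : realType) (d : nat) (x : R) (l : R) :
  0 <= l < 1 / 2 ->
  1 - expR (- (l * x)) * (Num.sqrt (1 - 2 * l))^-1 ^+ d <= ncchi2_cdf 0 d x.
Proof.
move=> /andP[l0 l12].
have mX : measurable (sq_dist (ncp_mean 0 d) @^-1` `]-oo, x] : set (d.-tuple R)).
  by rewrite -[X in measurable X]setTI; exact: measurable_sq_dist.
rewrite lerBlDr -lerBlDl -lee_fin EFinB /ncchi2_cdf fineK ?fin_num_measure//.
rewrite /cdf /distribution /pushforward -probability_setC//.
have := @std_gaussian_chernoff R d (ncp_mean 0 d) l x
  (~` (sq_dist (ncp_mean 0 d) @^-1` `]-oo, x])) l12.
rewrite big1 ?mulr0 ?mul0r ?expR0 ?mulr1; last first.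
  by move=> i _; rewrite mxE sqrtr0 if_same expr0n.
apply; first exact: measurableC.
move=> t /=; rewrite in_itv/= => /negP; rewrite -ltNge => /ltW ?.
exact: ler_wpM2l.
Qed.

(** Invert [1 + y <= expR y] at [y = u ^+ 2 - u], using (1 + u)(1 - u + u^2) = 1 + u^3 >= 1. *)
Lemma expR_le_addr1 (R : realType) (u : R) : 0 <= u -> expR (u - u ^+ 2) <= 1 + u.
Proof.
move=> u0.
have p : 0 < 1 - u + u ^+ 2 by nra.
rewrite -[u - _]opprK expRN -[leRHS]invrK lef_pV2 ?posrE ?expR_gt0 ?invr_gt0; last 2 first.
- by lra.
- by lra.
apply: le_trans (expR_ge1Dx _).
rewrite -[leLHS]mul1r ler_pdivrMr; nra.
Qed.

(** Same inversion, with (1 - u)(1 + u + 2u^2) = 1 + u^2 (1 - 2u) >= 1. *)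
Lemma expR_le_subr1 (R : realType) (u : R) :
  0 <= u <= 1 / 2 -> expR (- u - 2 * u ^+ 2) <= 1 - u.
Proof.
move=> /andP[u0 u12].
have p : 0 < 1 + u + 2 * u ^+ 2 by nra.
rewrite -opprD expRN -[leRHS]invrK lef_pV2 ?posrE ?expR_gt0 ?invr_gt0; last 2 first.
- by lra.
- by lra.
apply: le_trans (expR_ge1Dx _).
rewrite -[leLHS]mul1r ler_pdivrMr; last lra.
have : 0 <= u ^+ 2 * (1 - 2 * u) by apply: mulr_ge0; [exact: sqr_ge0|lra].
nra.
Qed.

Lemma invr_sqrt_le_expR (R : realType) (s v : R) :
  0 < s -> expR (- (2 * v)) <= s -> (Num.sqrt s)^-1 <= expR v.
Proof.
move=> s0 vs.
rewrite -[expR v]invrK -expRN lef_pV2 ?posrE ?invr_gt0 ?expR_gt0 ?sqrtr_gt0//.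
rewrite -[leLHS]ger0_norm ?expR_ge0// -sqrtr_sqr ler_sqrt ?(ltW s0)//.
rewrite expr2 -expRD; apply: (le_trans _ vs); rewrite ler_expR; lra.
Qed.

(** [expR_le_addr1] at [u = 2 * l] handles the power of [1 + 2 * l]; in the noncentral factor,
    [l <= 1 / 2] gives [1 + 2 * l <= 2]. *)
Lemma le_ncchi2_cdf_expR (R : realType) (z : R) (d : nat) (x l : R) :
  0 <= z -> (0 < d)%N -> 0 <= l <= 1 / 2 ->
  ncchi2_cdf z d x <= expR (l * (x - d%:R) + 2 * d%:R * l ^+ 2 - l * z / 2).
Proof.
move=> z0 d0 /andP[l0 l12].
apply: (le_trans (le_ncchi2_cdf x z0 d0 l0)).
have -> : l * (x - d%:R) + 2 * d%:R * l ^+ 2 - l * z / 2 =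
  l * x + (d%:R * (- l + 2 * l ^+ 2) + - (l * z / 2)) by ring.
rewrite !expRD expRM_natl.
apply: ler_wpM2l; first exact: expR_ge0.
apply: ler_pM; rewrite ?expR_ge0// ?exprn_ge0 ?invr_ge0 ?sqrtr_ge0//.
- apply: lerXn2r; rewrite ?nnegrE ?expR_ge0 ?invr_ge0 ?sqrtr_ge0//.
  apply: invr_sqrt_le_expR; first lra.
  apply: (le_trans _ (@expR_le_addr1 R (2 * l) _)); last lra.
  by rewrite ler_expR; lra.
- rewrite ler_expR lerN2 ler_wpM2l ?mulr_ge0// lef_pV2 ?posrE; lra.
Qed.

(** Uses [expR_le_subr1] at [u = 2 * l], whence the range [l <= 1 / 4]. *)
Lemma ge_chi2_cdf_expR (R : realType) (d : nat) (x l : R) :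
  0 <= l <= 1 / 4 ->
  1 - expR (- (l * (x - d%:R)) + 4 * d%:R * l ^+ 2) <= ncchi2_cdf 0 d x.
Proof.
move=> /andP[l0 l14].
apply: (le_trans _ (@ge_chi2_cdf R d x l _)); last lra.
rewrite lerD2l lerN2.
have -> : - (l * (x - d%:R)) + 4 * d%:R * l ^+ 2 =
  - (l * x) + d%:R * (l + 4 * l ^+ 2) by ring.
rewrite expRD expRM_natl.
apply: ler_wpM2l; first exact: expR_ge0.
apply: lerXn2r; rewrite ?nnegrE ?expR_ge0 ?invr_ge0 ?sqrtr_ge0//.
apply: invr_sqrt_le_expR; first lra.
apply: (le_trans _ (@expR_le_subr1 R (2 * l) _)); last by apply/andP; split; lra.
by rewrite ler_expR; lra.
Qed.

(** * Bounds on central chi-square quantiles *)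

Lemma ncchi2_quantile_le (R : realType) (z : R) (d : nat) (u x : R) :
  1 - u <= ncchi2_cdf z d x -> (ncchi2_quantile z d u <= x%:E)%E.
Proof. by move=> ux; apply: ereal_inf_lbound; exists x. Qed.

(** At [l = 1 / 4] the Chernoff exponent is -d/2 - ln(1/u), at most ln u. *)
Lemma chi2_quantile_le (R : realType) (d : nat) (u : R) :
  0 < u -> (ncchi2_quantile 0 d u <= (4 * (d%:R + ln (1 / u)))%:E)%E.
Proof.
move=> u0; apply: ncchi2_quantile_le.
apply: (le_trans _ (@ge_chi2_cdf_expR R d _ (1 / 4) _)); last by apply/andP; split; lra.
rewrite lerD2l lerN2 -[leRHS]lnK ?posrE// ler_expR (div1r u) lnV ?posrE//.
have := ler0n R d; lra.
Qed.

(** At [l = 1 / (4 * sqrt d)] the quadratic term of the exponent is exactly 1/4, which the 1 in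
    front of [4 * ln (1 / u)] cancels; what remains equals ln u. *)
Lemma chi2_quantile_le_sqrt (R : realType) (d : nat) (u : R) : (0 < d)%N ->
  0 < u -> (ncchi2_quantile 0 d u <=
            (d%:R + (1 + 4 * ln (1 / u)) * Num.sqrt d%:R)%:E)%E.
Proof.
move=> d0 u0; apply: ncchi2_quantile_le.
have d1 : 1 <= d%:R :> R by rewrite ler1n.
have s1 : 1 <= Num.sqrt d%:R :> R by rewrite -[leLHS]sqrtr1 ler_sqrt; lra.
have ds : d%:R = Num.sqrt d%:R ^+ 2 :> R by rewrite sqr_sqrtr; lra.
set s : R := Num.sqrt d%:R in s1 ds *.
apply: (le_trans _ (@ge_chi2_cdf_expR R d _ (1 / (4 * s)) _)); last first.
  apply/andP; split; first by rewrite divr_ge0//; lra.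
  by rewrite !div1r lef_pV2 ?posrE ?ler_peMr//; lra.
rewrite lerD2l lerN2 -[leRHS]lnK ?posrE// ler_expR (div1r u) lnV ?posrE// ds.
rewrite le_eqVlt; apply/orP; left; apply/eqP; field.
by rewrite gt_eqF//; lra.
Qed.

(** Excludes the value -oo and makes the critical value positive. The choice of [l] gives
    [1 + 2 * l = a ^+ 2], so for [y < l^-1] the distribution function at [y] is below e a^(-d) <= e
    / a = 1 - u. *)
Lemma chi2_quantile_ge (R : realType) (u : R) : 0 < u < 1 ->
  exists2 x : R, 0 < x & forall d, (0 < d)%N -> (x%:E <= ncchi2_quantile 0 d u)%E.
Proof.
move=> /andP[u0 u1]; set a := expR 1 / (1 - u).
have a1 : 1 < a.
  rewrite ltr_pdivlMr; last lra.
  have := @expR_ge1Dx R 1; lra.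
have l0 : 0 < (a ^+ 2 - 1) / 2 by nra.
set l := (a ^+ 2 - 1) / 2 in l0 *.
exists l^-1; first by rewrite invr_gt0.
move=> d d0; apply: le_ereal_inf_tmp => _ [y /= uy <-]; rewrite lee_fin leNgt.
apply/negP => yl; move: uy; apply/negP; rewrite -ltNge.
apply: (le_lt_trans (le_ncchi2_cdf y (lexx 0) d0 (ltW l0))).
rewrite mulr0 mul0r oppr0 expR0 mulr1.
have -> : 1 + 2 * l = a ^+ 2 by rewrite /l; field.
rewrite sqrtr_sqr ger0_norm; last lra.
have -> : 1 - u = expR 1 * a^-1.
  by rewrite /a invf_div mulrCA mulfV ?mulr1// gt_eqF// expR_gt0.
apply: (@lt_le_trans _ _ (expR 1 * a^-1 ^+ d)).
  rewrite ltr_pM2r ?exprn_gt0 ?invr_gt0//; last lra.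
  by rewrite ltr_expR mulrC -ltr_pdivlMr// div1r.
rewrite ler_pM2l ?expR_gt0// -[leRHS]expr1.
apply: ler_wiXn2l => //; first by rewrite invr_ge0; lra.
by rewrite invf_le1; lra.
Qed.

(** * Positivity of the distribution function *)

(** On the interval |x| <= [M], so the density is at least the constant [c > 0]. *)
Lemma normal_prob_itv_gt0 (R : realType) (a b : R) : a < b ->
  (0 < normal_prob (0 : R) 1 `[a, b])%E.
Proof.
move=> ab; pose M := `|a| + `|b|.
pose c := normal_peak 1 * expR (- M ^+ 2 / 2) : R.
have c0 : 0 < c by rewrite mulr_gt0 ?expR_gt0 ?normal_peak_gt0.
rewrite /normal_prob.
apply: (@lt_le_trans _ _ (\int[lebesgue_measure]_(x in `[a, b]) c%:E)%E).
  rewrite integral_cst//= lebesgue_measure_itv/= lte_fin ab -EFinD -EFinM lte_fin.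
  by rewrite mulr_gt0// subr_gt0.
apply: ge0_le_integral => //=.
- by move=> x _; rewrite lee_fin ltW.
- apply: measurable_funTS; apply/measurable_EFinP; exact: measurable_normal_pdf.
- move=> x; rewrite in_itv/= => /andP[ax xb]; rewrite lee_fin normal_pdfE ?oner_eq0//.
  rewrite ler_pM2l ?normal_peak_gt0// ler_expR expr1n subr0.
  rewrite !mulNr lerN2 ler_pM2r ?invr_gt0// -[leLHS]real_normK ?num_real//.
  apply: lerXn2r; rewrite ?nnegrE ?addr_ge0// ler_norml; apply/andP; split.
  - have := ler_norm (- a); rewrite normrN => ?; have := normr_ge0 b; rewrite /M; lra.
  - have := ler_norm b; have := normr_ge0 a; rewrite /M; lra.
Qed.

(** The event contains a box centred at [- mu] with half-side [r], where d r^2 = x; its probability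
    is a product of positive factors. *)
Lemma ncchi2_cdf_gt0 (R : realType) (z : R) (d : nat) (x : R) :
  (0 < d)%N -> 0 < x -> 0 < ncchi2_cdf z d x.
Proof.
move=> d0 x0; rewrite /ncchi2_cdf -lte_fin fineK ?fin_num_measure//.
pose r := Num.sqrt (x / d%:R).
have d0R : 0 < d%:R :> R by rewrite ltr0n.
have r0 : 0 < r by rewrite sqrtr_gt0 divr_gt0.
pose mu := ncp_mean z d.
pose A (i : 'I_d) : set R := `[- mu 0 i - r, - mu 0 i + r]%classic.
have mA i : measurable (A i) by exact: measurable_itv.
apply: (@lt_le_trans _ _ (std_gaussian d [set t | forall i, A i (tnth t i)]%classic)).
  rewrite std_gaussian_box//.
  apply: (big_ind (fun y : \bar R => 0 < y)%E) => //.
    by move=> y1 y2; exact: mule_gt0.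
  by move=> i _; apply: normal_prob_itv_gt0; lra.
apply: le_measure; rewrite ?inE; first exact: measurable_box.
  by rewrite -[X in measurable X]setTI; exact: measurable_sq_dist.
move=> t /= At; rewrite in_itv/= /sq_dist.
apply: (@le_trans _ _ (\sum_(i < d) r ^+ 2)).
  apply: ler_sum => i _; have := At i; rewrite /A/= in_itv/= => /andP[? ?].
  by rewrite /mu in r0 *; nra.
rewrite sumr_const card_ord /r sqr_sqrtr; last by rewrite divr_ge0 ?ltW.
by rewrite -[leLHS]mulr_natr divfK// gt_eqF.
Qed.

(** * Acceptance probability at a large noncentrality *)

Lemma ncchi2_cdf_le_expRN (R : realType) (A L z x : R) (d : nat) :
  (0 < d)%N -> 0 <= A -> 0 <= L -> x <= d%:R + A * Num.sqrt d%:R ->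
  2 * A * Num.sqrt d%:R + 12 * (Num.sqrt (d%:R * L) + L) <= z ->
  ncchi2_cdf z d x <= expR (- L).
Proof.
move=> d0 A0 L0; rewrite sqrtrM ?ler0n//.
have s0 : 0 < Num.sqrt d%:R :> R by rewrite sqrtr_gt0 ltr0n.
have ds : d%:R = Num.sqrt d%:R ^+ 2 :> R by rewrite sqr_sqrtr// ler0n.
have t0 : 0 <= Num.sqrt L by exact: sqrtr_ge0.
have Lt : L = Num.sqrt L ^+ 2 by rewrite sqr_sqrtr.
set s : R := Num.sqrt d%:R in s0 ds *; set t := Num.sqrt L in t0 Lt *.
rewrite Lt {1}ds => xd zd.
have As0 : 0 <= A * s by rewrite mulr_ge0// ltW.
have st0 : 0 <= s * t by rewrite mulr_ge0// ltW.
have tt0 : 0 <= t ^+ 2 by exact: sqr_ge0.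
have z0 : 0 <= z by lra.
(* The parameter [l] is [t / s], capped at 1/2. In [z], the part [2 * A * s] cancels the excess of
   [x] over [d], and the constant 12 leaves room for the quadratic term, which is [2 * t ^+ 2] in
   the first case and at most [s * t] in the second. *)
have [ts|st] := leP t (s / 2).
- have l0 : 0 <= t / s by rewrite divr_ge0// ltW.
  have l12 : t / s <= 1 / 2 by rewrite ler_pdivrMr//; lra.
  apply: (le_trans (@le_ncchi2_cdf_expR R z d x (t / s) z0 d0 _)).
    by rewrite l0 l12.
  have xd' : t / s * (x - d%:R) <= t / s * (A * s) by apply: ler_wpM2l => //; rewrite ds; lra.
  have zd' : t / s * (2 * A * s + 12 * (s * t + t ^+ 2)) <= t / s * z by exact: ler_wpM2l.
  have tn : t / s * t ^+ 2 >= 0 by exact: mulr_ge0.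
  have e1 : t / s * (A * s) = A * t by field; rewrite gt_eqF.
  have e2 : t / s * (2 * A * s + 12 * (s * t + t ^+ 2)) =
      2 * (A * t) + 12 * t ^+ 2 + 12 * (t / s * t ^+ 2).
    by field; rewrite gt_eqF.
  have e3 : 2 * d%:R * (t / s) ^+ 2 = 2 * t ^+ 2.
    by rewrite ds; field; rewrite gt_eqF.
  rewrite ler_expR e3; lra.
- apply: (le_trans (@le_ncchi2_cdf_expR R z d x (1 / 2) z0 d0 _)).
    by apply/andP; split; lra.
  rewrite ler_expR ds.
  have : s ^+ 2 <= 2 * (s * t) by rewrite expr2; nra.
  lra.
Qed.

(** The two real bounds rule out infinite values, so [fine] returns the true quantile. *)
Lemma chi2_quantile_bounds (R : realType) (u : R) (d : nat) : 0 < u < 1 -> (0 < d)%N ->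
  0 < fine (ncchi2_quantile 0 d u) <= d%:R + (1 + 4 * ln (1 / u)) * Num.sqrt d%:R.
Proof.
move=> u01 d0; have /andP[u0 u1] := u01.
have [x x0 /(_ d d0) xq] := chi2_quantile_ge u01.
have := @chi2_quantile_le_sqrt R d u d0 u0.
case: (ncchi2_quantile 0 d u) xq => [q||]//=; rewrite !lee_fin => xq ->.
by rewrite (lt_le_trans x0 xq).
Qed.

(** Since [l <= ln (1 / b)], sqrt N is at most sqrt(n ln(1/b)) / sqrt l; this turns the threshold
    [2 * A * sqrt N] into a multiple of sqrt(n ln(1/b)). *)
Lemma acceptance_le (R : realType) (alpha l b z : R) (n N : nat) :
  0 < alpha < 1 -> (0 < N <= n)%N -> 0 < b <= 1 -> 0 < l <= ln (1 / b) ->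
  (2 * (1 + 4 * ln (1 / alpha)) / Num.sqrt l + 12)
    * (Num.sqrt (n%:R * ln (1 / b)) + ln (1 / b)) <= z ->
  ncchi2_cdf z N (fine (ncchi2_quantile 0 N alpha)) <= b.
Proof.
move=> a01 /andP[N0 Nn] /andP[b0 b1] /andP[l0]; set L := ln (1 / b) => lL.
set A := 1 + 4 * ln (1 / alpha) => zb.
have A0 : 0 <= A.
  have /andP[a0 a1] := a01.
  have : 0 <= ln (1 / alpha) by rewrite ln_ge0// ler_pdivlMr// mul1r ltW.
  rewrite /A; lra.
have L0 : 0 <= L by lra.
have -> : b = expR (- L) by rewrite /L div1r lnV ?posrE// opprK lnK.
have /andP[_ qN] := chi2_quantile_bounds a01 N0.
apply: (ncchi2_cdf_le_expRN N0 A0 L0 qN); apply: le_trans zb.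
have sl0 : 0 < Num.sqrt l by rewrite sqrtr_gt0.
have B0 : 0 <= 2 * A / Num.sqrt l by rewrite divr_ge0 ?(ltW sl0)// mulr_ge0.
have NnR : N%:R <= n%:R :> R by rewrite ler_nat.
have NL : Num.sqrt (N%:R * L) <= Num.sqrt (n%:R * L).
  by rewrite ler_wsqrtr// ler_wpM2r.
have : 2 * A / Num.sqrt l * Num.sqrt (N%:R * l) <=
       2 * A / Num.sqrt l * Num.sqrt (n%:R * L).
  by apply: ler_wpM2l => //; rewrite ler_wsqrtr// ler_pM// ltW.
rewrite (sqrtrM l (ler0n R N)) [_ / _ * (_ * _)]mulrACA mulVf ?gt_eqF// mulr1.
have := mulr_ge0 B0 L0.
rewrite mulrDl !mulrDr; lra.
Qed.

(** * The radius in its three cases *)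

Theorem proposition2p1 (R : realType) (alpha : R) (halpha : 0 < alpha < 1) :
  exists C : R,
  forall (n : nat) (sigma beta0 : R) (M : finType) (top : M)
    (S : M -> {vspace 'rV[R]_n}) (beta : M -> R),
  (1 <= n)%N ->
  0 < sigma ->
  0 < beta0 < 1 - alpha ->
  (forall m : M, 0 < beta m < 1) ->
  S top = fullv ->
  \sum_(m : M) beta m <= beta0 ->
  (forall m : M, m != top -> (\dim (S m))%:R <= n%:R / 2 :> R) ->
  forall m : M,
  (sq_radius sigma alpha top S beta m <=
   (C * Num.max (\dim (S m))%:R
          (Num.max (Num.sqrt (n%:R * ln (1 / beta m))) (ln (1 / beta m)))
      * sigma ^+ 2)%:E)%E.
Proof.
have /andP[a0 a1] := halpha.
pose l := ln (1 / (1 - alpha)); pose A := 1 + 4 * ln (1 / alpha).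
have l0 : 0 < l by rewrite ln_gt0// ltr_pdivlMr; lra.
pose K := 2 * A / Num.sqrt l + 12.
(* [2 * K] pays for [zs], which is [K] times two terms each at most [mx]; 8 pays for 4(D + L). *)
exists (2 * K + 8) => n sigma beta0 M top S beta n1 s0 /andP[_ b1a] hb Stop sumb hD m.
have s20 : 0 < sigma ^+ 2 by rewrite exprn_gt0.
have /andP[bm0 bm1] := hb m.
have bma : beta m < 1 - alpha.
  apply: le_lt_trans b1a; apply: le_trans sumb; rewrite (bigD1 m)//= lerDl.
  by apply: sumr_ge0 => i _; have /andP[/ltW] := hb i.
set L := ln (1 / beta m).
have lL : l <= L.
  by rewrite ler_ln ?posrE ?divr_gt0 ?subr_gt0// !div1r lef_pV2 ?posrE ?subr_gt0// ltW.
have K0 : 0 <= K.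
  have : 0 <= A.
    have : 0 <= ln (1 / alpha) by rewrite ln_ge0// ler_pdivlMr// mul1r ltW.
    rewrite /A; lra.
  move=> A0; have : 0 <= 2 * A / Num.sqrt l by rewrite divr_ge0 ?sqrtr_ge0// mulr_ge0.
  rewrite /K; lra.
set D := \dim (S m); set mx := Num.max _ _.
have Dmx : D%:R <= mx by rewrite /mx le_max lexx.
have sqmx : Num.sqrt (n%:R * L) <= mx by rewrite /mx !le_max lexx orbT.
have Lmx : L <= mx by rewrite /mx !le_max lexx !orbT.
have mx0 : 0 <= mx by apply: le_trans Dmx.
pose zs := K * (Num.sqrt (n%:R * L) + L).
have zsmx : zs <= 2 * K * mx.
  by rewrite /zs -mulrA mulrCA; apply: ler_wpM2l => //; lra.
have zs0 : 0 <= zs by rewrite mulr_ge0// addr_ge0 ?sqrtr_ge0//; lra.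
have acc N z : (0 < N <= n)%N -> zs <= z ->
    ncchi2_cdf z N (fine (ncchi2_quantile 0 N alpha)) <= beta m.
  move=> Nn; apply: (acceptance_le halpha Nn) => //; last by rewrite l0.
  by rewrite bm0 ltW.
rewrite EFinM /sq_radius lee_pmul2r//.
have [mtop|mtop] := eqVneq m top.
  apply: (le_trans (chi2_quantile_le n bm0)); rewrite lee_fin.
  have -> : n = D by rewrite /D mtop Stop dimvf /dim/= mul1n.
  have := mulr_ge0 K0 mx0; rewrite -/L; lra.
have Dn : (0 < n - D)%N.
  rewrite subn_gt0 -(ltr_nat R); apply: le_lt_trans (hD m mtop) _.
  have : 1 <= n%:R :> R by rewrite ler1n.
  lra.
(* For [D = 0] the point [zs] belongs to the set whose infimum is taken. *)
case: ifP => [/eqP D0|_].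
  apply: (@le_trans _ _ zs%:E); last by rewrite lee_fin; lra.
  apply: ereal_inf_lbound; exists zs => //=; split => //.
  by apply: acc => //; rewrite n1 leqnn.
apply: ge_ereal_sup => _ [z /= z0 <-].
set acz := ncchi2_cdf z _ _.
(* Otherwise beta m / acz would be the junk value 0, with quantile +oo. *)
have acz0 : 0 < acz.
  by apply: ncchi2_cdf_gt0 => //; have /andP[] := chi2_quantile_bounds halpha Dn.
have acz1 : acz <= 1 by rewrite /acz -lee_fin fineK ?fin_num_measure// cdf_le1.
(* If [acz <= beta m], the quantile is taken at 1: every real satisfies its defining condition, so
   the term is -oo. Otherwise [acc] forces [z <= zs]. *)
have [ab|ba] := leP acz (beta m).
  have -> : Num.min (beta m / acz) 1 = 1.
    by apply/min_idPr; rewrite ler_pdivlMr// mul1r.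
  have -> : ncchi2_quantile (0 : R) D 1 = -oo%E.
    rewrite /ncchi2_quantile -[RHS](@ereal_inf_real R); congr ereal_inf.
    apply/seteqP; split => _ [x _ <-]; exists x => //=.
    by rewrite subrr /ncchi2_cdf fine_ge0.
  by rewrite addeNy leNye.
have -> : Num.min (beta m / acz) 1 = beta m / acz.
  by apply/min_idPl; rewrite ler_pdivrMr// mul1r ltW.
have zzs : z <= zs.
  rewrite leNgt; apply/negP => /ltW zz; move: ba; rewrite ltNge.
  by rewrite acc// Dn leq_subr.
apply: (@le_trans _ _ (zs%:E + (4 * (D%:R + L))%:E)%E); last first.
  by rewrite -EFinD lee_fin; lra.
apply: leeD; first by rewrite lee_fin.
(* As [acz <= 1], the level [beta m / acz] is at least [beta m], so its logarithmic term is at most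
   [L]. *)
apply: (le_trans (chi2_quantile_le D (divr_gt0 bm0 acz0))).
rewrite lee_fin ler_pM2l// lerD2l ler_ln ?posrE ?div1r ?invr_gt0 ?divr_gt0//.
rewrite lef_pV2 ?posrE ?divr_gt0// ler_pdivlMr// -[leRHS]mulr1.
by apply: ler_wpM2l => //; exact: ltW.
Qed.
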